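(* Every weighted quasi-metric space with generalized weight can be embedded in a generalized bundle over a suitable metric space. That is, for every weighted quasi-metric space $(M,q,\omega)$ with generalized weight $\omega:M\to\mathbb{R}$ there exist a metric space $(S,d)$ and a generalized bundle $(N,Q,W)$ over $(S,d)$ such that $(M,q,\omega)$ admits an embedding into $(N,Q,W)$.
   Context: A quasi-metric on a set $M$ is a function $q:M\times M\to[0,\infty)$ such that for all $x,y,z\in M$: (a) $q(x,y)>0$ if $x\neq y$, and $q(x,x)=0$; (b) $q(x,y)\le q(x,z)+q(z,y)$; (c) $q(x,y)=q(y,x)=0$ implies $x=y$. A weighted quasi-metric space with generalized weight is a triple $(M,q,\omega)$ with $q$ a quasi-metric on $M$ and $\omega:M\to\mathbb{R}$ such that $q(x,y)+\omega(x)=q(y,x)+\omega(y)$ for all $x,y\in M$. A generalized bundle over a metric space $(S,d)$ is the triple $(N,Q,W)$ with $N=S\times\mathbb{R}$, $Q((x,\xi),(y,\eta))=d(x,y)+\lambda(\eta-\xi)$ and $W(x,\xi)=2\lambda\xi$ for $x,y\in S$, $\xi,\eta\in\mathbb{R}$, where $\lambda\ge1$ is an integer. An isomorphism from $(M,q,\omega)$ to $(M',q',\omega')$ is a bijection $\psi:M\to M'$ with $q(x,y)=q'(\psi(x),\psi(y))$ and $\omega(x)=\omega'(\psi(x))$ for all $x,y\in M$. An embedding of $(M,q,\omega)$ into $(N,Q,W)$ is an isomorphism of $(M,q,\omega)$ onto a subspace $(M',q',\omega')$ of $(N,Q,W)$, where $M'\subset N$ and $q',\omega'$ are the restrictions of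 $Q,W$ to $M'\times M'$ and $M'$ respectively. *)

(* Defs.v *)
From Stdlib Require Import Reals FinFun.
Open Scope R_scope.

(* A triple (M, q, omega) with no axioms.  The axioms are kept apart because
   the distance Q of a generalized bundle may be negative, so that a bundle
   need not be a quasi-metric space. *)
Record weighted_triple : Type := WeightedTriple {
  carrier : Type;
  qdist : carrier -> carrier -> R;
  weight : carrier -> R
}.

Record is_quasi_metric (M : Type) (q : M -> M -> R) : Prop := {
  qm_nonneg : forall x y, 0 <= q x y;
  qm_pos : forall x y, x <> y -> 0 < q x y;
  qm_refl : forall x, q x x = 0;
  qm_tri : forall x y z, q x y <= q x z + q z y;
  qm_sep : forall x y, q x y = 0 -> q y x = 0 -> x = y
}.

Definition is_generalized_weight (M : Type) (q : M -> M -> R) (w : M -> R) : Prop :=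
  forall x y, q x y + w x = q y x + w y.

Definition is_weighted_quasi_metric_space (X : weighted_triple) : Prop :=
  is_quasi_metric (carrier X) (qdist X) /\
  is_generalized_weight (carrier X) (qdist X) (weight X).

Definition generalized_bundle (S : Metric_Space) (lambda : Z) : weighted_triple := {|
  carrier := Base S * R;
  qdist := fun p p' => dist S (fst p) (fst p') + IZR lambda * (snd p' - snd p);
  weight := fun p => 2 * IZR lambda * snd p
|}.

Definition is_isomorphism (X Y : weighted_triple) (psi : carrier X -> carrier Y) : Prop :=
  Bijective psi /\
  (forall x y, qdist X x y = qdist Y (psi x) (psi y)) /\
  (forall x, weight X x = weight Y (psi x)).

Definition subspace (Y : weighted_triple) (P : carrier Y -> Prop) : weighted_triple := {|
  carrier := {y : carrier Y | P y};
  qdist := fun u v => qdist Y (proj1_sig u) (proj1_sig v);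
  weight := fun u => weight Y (proj1_sig u)
|}.

Definition admits_embedding (X Y : weighted_triple) : Prop :=
  exists (P : carrier Y -> Prop) (psi : carrier X -> carrier (subspace Y P)),
    is_isomorphism X (subspace Y P) psi.

(* Main.v *)
(** Split [q] into its symmetric part [d x y = (q x y + q y x) / 2] and its
    antisymmetric part [(q x y - q y x) / 2], which the weight identity turns
    into [(w y - w x) / 2].  The symmetric part is a metric on [M], and
    [x |-> (x, w x / 2)] embeds [M] as a graph in the bundle over [(M, d)] with
    [lambda = 1]. *)

Require Import Defs.
From Stdlib Require Import Reals Lra Lia.
Open Scope R_scope.

Definition symmetrization (M : Type) (q : M -> M -> R) (x y : M) : R :=
  (q x y + q y x) / 2.

(** Kept transparent so that [Base] and [dist] compute to [M] and [symmetrization M q]; the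
    embedding below relies on this to type its points in [M * R]. *)
Definition symmetrized_space (M : Type) (q : M -> M -> R)
    (hq : is_quasi_metric M q) : Metric_Space.
Proof.
  refine (Build_Metric_Space M (symmetrization M q) _ _ _ _);
    unfold symmetrization.
  - intros x y.
    pose proof (qm_nonneg M q hq x y). pose proof (qm_nonneg M q hq y x). lra.
  - intros x y. lra.
  - intros x y. split.
    + intros H.
      pose proof (qm_nonneg M q hq x y). pose proof (qm_nonneg M q hq y x).
      apply (qm_sep M q hq); lra.
    + intros <-. rewrite (qm_refl M q hq). lra.
  - intros x y z.
    pose proof (qm_tri M q hq x y z). pose proof (qm_tri M q hq y x z). lra.
Defined.

Theorem theorem5p1 (X : weighted_triple) (hX : is_weighted_quasi_metric_space X) :
  exists (S : Metric_Space) (lambda : Z),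
    (1 <= lambda)%Z /\ admits_embedding X (generalized_bundle S lambda).
Proof.
  destruct X as [M q w], hX as [hq hw]; cbn in hq, hw.
  exists (symmetrized_space M q hq), 1%Z.
  split; [lia |].
  exists (fun p : M * R => snd p = w (fst p) / 2).
  exists (fun x : M =>
    exist (fun p : M * R => snd p = w (fst p) / 2) (x, w x / 2) eq_refl).
  split; [| split]; cbn.
  - exists (fun u => fst (proj1_sig u)). split; [reflexivity |].
    (* On the graph [e] determines [r]; eliminating [r] turns [e] into [eq_refl], so the two
       subspace elements agree, membership proofs included. *)
    intros [[x r] e]; cbn in *. subst r. reflexivity.
  - intros x y. unfold symmetrization. specialize (hw x y). lra.
  - intros x. lra.
Qed.
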